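(* Let $n\ge 3$, $0\le m<\frac{n-2}{n}$, $\rho_1>0$, $\lambda>0$, $\beta>\beta_0^{(m)}:=\frac{m\rho_1}{n-2-nm}$ and $\alpha_m=\frac{2\beta+\rho_1}{1-m}$. Let $v=v^{(m)}$ be a radially symmetric solution of $$\Delta\phi_m(v)+\alpha_m v+\beta x\cdot\nabla v=0,\quad v>0,\quad\text{in }\mathbb{R}^n\setminus\{0\}$$ which satisfies $$\lim_{|x|\to 0}|x|^{\alpha_m/\beta}v(x)=\lambda^{-\frac{\rho_1}{(1-m)\beta}}.$$ For $r>0$ let $\tilde w(r)=r^{\alpha_m/\beta}v(r)$, $\rho=r^{\rho_1/\beta}$ and $\overline{w}(\rho)=\tilde w(r)$. Then $\overline{w}$ can be extended to a function in $C^2([0,\infty))$ by setting $$\overline{w}(0)=\lambda^{-\frac{\rho_1}{(1-m)\beta}},\quad \overline{w}_\rho(0)=A_1\lambda^{-\frac{m\rho_1}{(1-m)\beta}},\quad \overline{w}_{\rho\rho}(0)=A_2\lambda^{-\frac{(2m-1)\rho_1}{(1-m)\beta}},$$ where $A_1=\frac{a_3}{a_2}$, $A_2=\frac{a_3(ma_3-a_1)}{a_2^2}$ and $$a_1=\frac{(n-2)\beta-2m\alpha_m+\rho_1}{\rho_1},\quad a_2=\frac{\beta^2}{\rho_1},\quad a_3=\frac{\alpha_m\beta(n-2)-m\alpha_m^2}{\rho_1^2}.$$ Hence, as $\rho\to0^+$, $$\overline{w}(\rho)=\lambda^{-\frac{\rho_1}{(1-m)\beta}}+A_1\lambda^{-\frac{m\rho_1}{(1-m)\beta}}\rho+\frac{A_2}{2}\lambda^{-\frac{(2m-1)\rho_1}{(1-m)\beta}}\rho^2+o(\rho^2),$$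 $$\overline{w}_\rho(\rho)=A_1\lambda^{-\frac{m\rho_1}{(1-m)\beta}}+A_2\lambda^{-\frac{(2m-1)\rho_1}{(1-m)\beta}}\rho+o(\rho),$$ or equivalently, as $r\to0^+$, $$v^{(m)}(r)=r^{-\frac{\alpha_m}{\beta}}\left[\lambda^{-\frac{\rho_1}{(1-m)\beta}}+A_1\lambda^{-\frac{m\rho_1}{(1-m)\beta}}r^{\frac{\rho_1}{\beta}}+\frac{A_2}{2}\lambda^{-\frac{(2m-1)\rho_1}{(1-m)\beta}}r^{\frac{2\rho_1}{\beta}}+o\left(r^{\frac{2\rho_1}{\beta}}\right)\right],$$ $$(v^{(m)})'(r)=r^{-\frac{\alpha_m}{\beta}-1}\left[-\frac{\alpha_m}{\beta}\lambda^{-\frac{\rho_1}{(1-m)\beta}}-\frac{2\beta+m\rho_1}{(1-m)\beta}A_1\lambda^{-\frac{m\rho_1}{(1-m)\beta}}r^{\frac{\rho_1}{\beta}}+o\left(r^{\frac{\rho_1}{\beta}}\right)\right].$$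
   Context: $\phi_m(u)=u^m/m$ if $m\ne0$ and $\phi_0(u)=\log u$. A solution of the elliptic equation in $\mathbb{R}^n\setminus\{0\}$ is a positive function $v\in C^2(\mathbb{R}^n\setminus\{0\})$ satisfying the equation in the classical sense. A radially symmetric $v$ is also written as a function $v(r)$ of $r=|x|$, and $'$ denotes $d/dr$; subscripts $\rho$ denote derivatives with respect to $\rho$. *)

(* Defs.v *)
From mathcomp Require Import all_boot all_order all_algebra.
From mathcomp Require Import all_classical all_reals all_analysis.

Set Implicit Arguments.
Unset Strict Implicit.
Unset Printing Implicit Defensive.

Import Order.TTheory GRing.Theory Num.Theory.
Import numFieldNormedType.Exports.

Local Open Scope classical_set_scope.
Local Open Scope ring_scope.

(* The norm that the library puts on ['rV[R]_n] is the sup norm (with the same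
   topology), so the Euclidean norm [|x|] is defined here. *)
Definition enorm (R : realType) (n : nat) (x : 'rV[R]_n) : R :=
  Num.sqrt (\sum_(i < n) x 0 i ^+ 2).

Definition partial (R : realType) (n : nat) (i : 'I_n) (f : 'rV[R]_n -> R) :
    'rV[R]_n -> R :=
  fun x => 'D_(delta_mx 0 i) f x.

(* For open [U]. *)
Definition C1_on (R : realType) (n : nat) (U : set 'rV[R]_n)
    (f : 'rV[R]_n -> R) : Prop :=
  forall x, U x -> {for x, continuous f} /\
    forall i : 'I_n,
      derivable f x (delta_mx 0 i) /\ {for x, continuous (partial i f)}.

Definition C2_on (R : realType) (n : nat) (U : set 'rV[R]_n)
    (f : 'rV[R]_n -> R) : Prop :=
  C1_on U f /\ forall i : 'I_n, C1_on U (partial i f).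

Definition laplacian (R : realType) (n : nat) (f : 'rV[R]_n -> R)
    (x : 'rV[R]_n) : R :=
  \sum_(i < n) partial i (partial i f) x.

Definition x_dot_grad (R : realType) (n : nat) (f : 'rV[R]_n -> R)
    (x : 'rV[R]_n) : R :=
  \sum_(i < n) x 0 i * partial i f x.

Definition phi (R : realType) (m u : R) : R :=
  if m == 0 then ln u else u `^ m / m.

(* A function on [R^n \ {0}] is a total function whose value at [0] is
   irrelevant: only points [x != 0] are constrained. *)
Definition elliptic_solution (R : realType) (n : nat) (m alpha beta : R)
    (v : 'rV[R]_n -> R) : Prop :=
  C2_on [set x : 'rV[R]_n | x != 0] v /\
  forall x : 'rV[R]_n, x != 0 ->
    0 < v x /\
    laplacian (phi m \o v) x + alpha * v x + beta * x_dot_grad v x = 0.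

(* [v] is radially symmetric, and [vr] is [v] written as a function of
   [r = |x|]; this determines [vr r] for [r > 0] when [0 < n]. *)
Definition radial_profile (R : realType) (n : nat) (v : 'rV[R]_n -> R)
    (vr : R -> R) : Prop :=
  forall x : 'rV[R]_n, x != 0 -> v x = vr (enorm x).

(* [f' x] is the derivative of [f] at [x] relative to [D], for all [x] in [D];
   for an interval this is the one-sided derivative at an endpoint. *)
Definition derivative_on (R : realType) (D : set R) (f f' : R -> R) : Prop :=
  forall x, D x -> (f y - f x) / (y - x) @[y --> within D x^'] --> f' x.

(* [f] is C^2 on [D], with first and second derivatives [f1] and [f2]. *)
Definition C2_with (R : realType) (D : set R) (f f1 f2 : R -> R) : Prop :=
  [/\ derivative_on D f f1, derivative_on D f1 f2 &
      {within D, continuous f2}].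

Section Constants.
Context {R : realType}.
Variables (n : nat) (m rho1 beta : R).

Definition beta0 : R := m * rho1 / (n%:R - 2 - n%:R * m).
Definition alpha_m : R := (2 * beta + rho1) / (1 - m).
Definition coef_a1 : R := ((n%:R - 2) * beta - 2 * m * alpha_m + rho1) / rho1.
Definition coef_a2 : R := beta ^+ 2 / rho1.
Definition coef_a3 : R :=
  (alpha_m * beta * (n%:R - 2) - m * alpha_m ^+ 2) / rho1 ^+ 2.
Definition coef_A1 : R := coef_a3 / coef_a2.
Definition coef_A2 : R := coef_a3 * (m * coef_a3 - coef_a1) / coef_a2 ^+ 2.

End Constants.

(* Main.v *)
Require Import Defs.
From mathcomp Require Import all_boot all_order all_algebra.
From mathcomp Require Import all_classical all_reals all_analysis.
From mathcomp Require Import ring lra.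

(** Let [x = r^(rho1/beta)] and [w(x) = r^(alpha/beta) v(r)]. Because
    [alpha = (2 beta + rho1)/(1 - m)], the radial form of the elliptic equation
    becomes, for [h = w^(m-1) w'],
      [x^2 h' = - (a2 w^(1-m) + a1 x) h + a3 w^m],
    a first-order linear equation for [h] with an irregular singular point at
    [x = 0]. For a coefficient [p] and a source [q] with limits [p0 > 0] and
    [q0], the solutions of [x^2 y' = - p y + q] either grow like [exp(p0/x)]
    or tend to [q0/p0] at [0] ([irregular_ode_cvg]). Since [w] converges, the
    mean value theorem makes [x w'] small along a sequence tending to [0], which
    excludes exponential growth of [h]; so [h], and with it [w'], converges.

    Differentiating the equation once gives an equation of the same kind for
    [h'], with coefficient [p + 2 x] and source [q' - p' h]; both have limits
    because [w'] has one. The convergence of [h] makes [x h'] small along a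
    sequence, so [h'] converges, and hence [w''] ([profile_ode_cvg]); the limits
    are [A1 c0^m] and [A2 c0^(2m-1)].

    A function whose first two derivatives have limits at [0+] extends to a C^2
    function on the closed half line, and the mean value theorem turns this
    into the Taylor expansions of [w] and [w'] ([extend0_C2_with],
    [taylor1_at_right0], [taylor2_at_right0]). Substituting [x = r^(rho1/beta)]
    yields those of [v] and [v'].

    The radial equation itself only needs one-variable calculus: a partial
    derivative is a derivative along a line, and a radial function restricted
    to a line is a composition with [h |-> sqrt (|x|^2 + 2 x_i h + h^2)]
    ([laplacian_radial], [radial_profile_ode]). *)

Set Implicit Arguments.
Unset Strict Implicit.
Unset Printing Implicit Defensive.

Import Order.TTheory GRing.Theory Num.Theory.
Import numFieldNormedType.Exports.

Local Open Scope classical_set_scope.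
Local Open Scope ring_scope.

(** * Behaviour at an irregular singular point *)

Lemma near_at_right0P (R : realType) (P : set R) :
  (\forall x \near 0^'+, P x) <->
  exists2 d : R, 0 < d & forall x, 0 < x < d -> P x.
Proof.
split.
  move=> [d /= d0 H]; exists d => // x /andP[x0 xd]; apply: H => //=.
  by rewrite sub0r normrN gtr0_norm.
move=> [d d0 H]; near=> x; apply: H; apply/andP; split.
- by near: x; exact: nbhs_right_gt.
- by near: x; exact: nbhs_right_lt.
Unshelve. all: by end_near. Qed.

Lemma near_at_right0S (R : realType) (P Q : set R) :
  (forall x : R, 0 < x -> P x -> Q x) ->
  (\forall x \near 0^'+, P x) -> \forall x \near 0^'+, Q x.
Proof.
move=> PQ /near_at_right0P[d d0 H]; apply/near_at_right0P; exists d => // x.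
by move=> /[dup] /H Px /andP[x0 _]; exact: PQ.
Qed.

(** A convergent function has a derivative that is [o(1/x)] along some sequence
    tending to [0]. *)
Lemma cvg_at_right_small_derive (R : realType) (f df : R -> R) (l : R) :
  (forall x : R, 0 < x -> is_derive x 1 f (df x)) ->
  f @ 0^'+ --> l ->
  forall eps d : R, 0 < eps -> 0 < d ->
  exists2 x : R, 0 < x < d & `|x * df x| < eps.
Proof.
move=> fdf /cvgrPdist_lt fl eps d eps0 d0.
have /near_at_right0P[d1 d10 H] := fl (eps / 4) ltac:(lra).
pose s := Num.min d d1 / 2.
have s0 : 0 < s by rewrite divr_gt0// lt_min d0.
have sd : s < d.
  by have : Num.min d d1 <= d; [rewrite ge_min lexx|rewrite /s; lra].
have sd1 : s < d1.
  by have : Num.min d d1 <= d1; [rewrite ge_min lexx orbT|rewrite /s; lra].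
have [|||c] := @MVT R f df (s / 2) s.
- by lra.
- move=> x; rewrite in_itv/= => /andP[x1 _]; apply: fdf; lra.
- apply: derivable_within_continuous => x; rewrite in_itv/= => /andP[x1 _].
  by apply: ex_derive; apply: fdf; lra.
rewrite in_itv/= => /andP[c1 c2] E; exists c; first by apply/andP; split; lra.
have := H s ltac:(apply/andP; split; lra).
have := H (s / 2) ltac:(apply/andP; split; lra).
have -> : `|c * df c| = c * `|df c| by rewrite normrM gtr0_norm//; lra.
have h1 : c * `|df c| <= s * `|df c| by rewrite ler_wpM2r// ltW.
have h2 : s / 2 * `|df c| = `|f s - f (s / 2)|.
  rewrite E normrM [`|s - _|]gtr0_norm; last lra.
  by rewrite mulrC; congr (_ * _); lra.
have h3 : `|f s - f (s / 2)| <= `|l - f (s / 2)| + `|l - f s|.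
  by rewrite [leRHS]addrC (distrC l (f s)); apply: ler_distD.
by lra.
Qed.

(** Near the irregular singular point [0], the equation
    [x^2 y' = - p(x) y + q(x)] with [p(0+) > 0] forces [y] to converge, unless
    [y] blows up at least as fast as [1/x]. Indeed [u = (y - q0/p0)^2 - eps^2]
    satisfies [x^2 u' <= - c u], so [u exp(-c/x)] is nonincreasing; were [u]
    positive somewhere, it would be larger than a multiple of [exp(c/x)]. *)
Lemma irregular_ode_cvg (R : realType) (y dy p q : R -> R) (p0 q0 : R) :
  0 < p0 ->
  (forall x : R, 0 < x -> is_derive x 1 y (dy x)) ->
  (forall x : R, 0 < x -> x ^+ 2 * dy x = - (p x * y x) + q x) ->
  p @ 0^'+ --> p0 -> q @ 0^'+ --> q0 ->
  (forall eps d : R, 0 < eps -> 0 < d ->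
     exists2 x : R, 0 < x < d & `|x * y x| < eps) ->
  y @ 0^'+ --> q0 / p0.
Proof.
move=> p0_gt0 yD yE pl ql ysmall.
set L := q0 / p0; apply/cvgrPdist_le => eps eps0.
pose c := p0 / 2; have c0 : 0 < c by rewrite divr_gt0.
have gl : q x - p x * L @[x --> 0^'+] --> (0 : R).
  have g0 : q0 - p0 * L = 0 by rewrite /L mulrCA divff ?gt_eqF// mulr1 subrr.
  suff : q x - p x * L @[x --> 0^'+] --> q0 - p0 * L by rewrite g0.
  by apply: cvgB => //; apply: cvgM => //; exact: cvg_cst.
have gN : \forall x \near 0^'+, `|q x - p x * L| <= c * eps.
  move/cvgrPdist_le : gl => /(_ (c * eps) (mulr_gt0 c0 eps0)).
  by apply: filterS => x; rewrite sub0r normrN.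
have pN : \forall x \near 0^'+, c <= p x.
  by apply: (cvgr_ge p0 pl c); rewrite /c; lra.
have /near_at_right0P[d d0 H] : \forall x \near 0^'+,
  `|q x - p x * L| <= c * eps /\ c <= p x by near=> x; split; near: x.
apply/near_at_right0P; exists d => // t /andP[t0 td].
rewrite distrC leNgt; apply/negP => yt.
pose u (x : R) : R := (y x - L) ^+ 2 - eps ^+ 2.
pose f (x : R) : R := u x * expR (- (c / x)).
pose df (x : R) : R := 2 * (y x - L) * dy x * expR (- (c / x)) +
             u x * (expR (- (c / x)) * (c / x ^+ 2)).
have ut : 0 < u t.
  rewrite /u subr_gt0 -[ltRHS]real_normK ?num_real//.
  by rewrite ltr_pXn2r// nnegrE ltW.
have ft : 0 < f t by rewrite mulr_gt0// expR_gt0.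
have fD (x : R) : 0 < x -> is_derive x 1 f (df x).
  move=> x0; have yx := yD x x0.
  have xV : is_derive x 1 (fun y : R => y^-1) (- x ^- 2 *: 1).
    by apply: is_deriveV; rewrite gt_eqF.
  have E1 : is_derive x 1 (fun x => - (c / x)) (c / x ^+ 2).
    by apply: is_derive_eq; rewrite /GRing.scale/=; field; rewrite gt_eqF.
  have E2 : is_derive x 1 (fun x => expR (- (c / x)))
      (expR (- (c / x)) * (c / x ^+ 2)).
    exact: (@is_derive1_comp _ expR (fun x => - (c / x))).
  have E3 : is_derive x 1 u (2 * (y x - L) * dy x).
    by apply: is_derive_eq; rewrite /GRing.scale/=; ring.
  by apply: is_derive_eq; rewrite /GRing.scale/= /df; ring.
have df_le0 (x : R) : 0 < x < d -> df x <= 0.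
  move=> /[dup] /andP[x0 _] /H[Hg Hp].
  have -> : df x = expR (- (c / x)) / x ^+ 2 *
      (2 * (y x - L) * (x ^+ 2 * dy x) + c * u x).
    by rewrite /df; field; rewrite gt_eqF.
  apply: mulr_ge0_le0.
    by rewrite divr_ge0 ?expR_ge0// exprn_ge0 ?ltW.
  rewrite yE// /u; set z := y x - L; set g := q x - p x * L in Hg.
  have -> : - (p x * y x) + q x = - (p x * z) + g by rewrite /z /g; ring.
  have zg : z * g <= `|z| * (c * eps).
    by apply: le_trans (ler_norm _) _; rewrite normrM ler_wpM2l.
  have zz : z ^+ 2 = `|z| ^+ 2 by rewrite real_normK ?num_real.
  have pz : c * z ^+ 2 <= p x * z ^+ 2 by rewrite ler_wpM2r// sqr_ge0.
  have : 0 <= c * (`|z| - eps) ^+ 2 by rewrite mulr_ge0 ?sqr_ge0// ltW.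
  by nra.
have fmono (s : R) : 0 < s < t -> f t <= f s.
  move=> /andP[s0 st].
  have [||xi] := @MVT R f df s t st.
  - by move=> x; rewrite in_itv/= => /andP[x1 _]; apply: fD; lra.
  - apply: derivable_within_continuous => x; rewrite in_itv/= => /andP[x1 _].
    by apply: ex_derive; apply: fD; lra.
  rewrite in_itv/= => /andP[x1 x2] E.
  have : df xi * (t - s) <= 0.
    by rewrite mulr_le0_ge0 ?df_le0//; [apply/andP; split|]; lra.
  by lra.
(* lower bound on [s^2 (y s - L)^2], from [exp(c/s) >= (c/(2 s))^2] *)
have lb (s : R) : 0 < s < t -> f t * (c / 2) ^+ 2 <= (s * (y s - L)) ^+ 2.
  move=> /[dup] /fmono fs /andP[s0 st].
  have e1 : c / (2 * s) <= expR (c / (2 * s)).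
    by apply: le_trans (expR_ge1Dx _); lra.
  have e2 : (c / (2 * s)) ^+ 2 <= expR (c / s).
    have -> : c / s = c / (2 * s) * 2%:R by field; rewrite gt_eqF.
    rewrite expRM_natr ler_pXn2r// nnegrE ?expR_ge0// divr_ge0 ?ltW//; lra.
  have e3 : u s = f s * expR (c / s).
    by rewrite /f -mulrA -expRD addNr expR0 mulr1.
  have e4 : f t * (c / (2 * s)) ^+ 2 <= u s.
    by rewrite e3 ler_pM ?sqr_ge0// ltW.
  have -> : f t * (c / 2) ^+ 2 = s ^+ 2 * (f t * (c / (2 * s)) ^+ 2).
    by field; rewrite gt_eqF.
  rewrite [leRHS]exprMn ler_wpM2l ?sqr_ge0//; apply: le_trans e4 _.
  by rewrite /u lerBlDr lerDl sqr_ge0.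
pose e0 := Num.sqrt (f t * (c / 2) ^+ 2) / 2.
have fc0 : 0 < f t * (c / 2) ^+ 2 by rewrite mulr_gt0// exprn_gt0// divr_gt0.
have e00 : 0 < e0 by rewrite divr_gt0// sqrtr_gt0.
have L0 : 0 < `|L| + 1 by have := normr_ge0 L; lra.
have [|s /andP[s0]] := ysmall e0 (Num.min t (e0 / (`|L| + 1))) e00.
  by rewrite lt_min t0 divr_gt0.
rewrite lt_min => /andP[st]; rewrite ltr_pdivlMr// => sL ys.
have := lb s ltac:(by rewrite s0).
apply/negP; rewrite -ltNge -real_normK ?num_real//.
have -> : f t * (c / 2) ^+ 2 = (2 * e0) ^+ 2.
  have -> : 2 * e0 = Num.sqrt (f t * (c / 2) ^+ 2) by rewrite /e0; field.
  by rewrite sqr_sqrtr// ltW.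
rewrite ltr_pXn2r// ?nnegrE//; last by lra.
rewrite mulrBr; apply: le_lt_trans (ler_normB _ _) _.
by rewrite [`|s * L|]normrM [`|s|]gtr0_norm//; lra.
Unshelve. all: by end_near. Qed.

(** The limit of the derivative at an endpoint is the one-sided derivative
    there. *)
Lemma cvg_derive_endpoint (R : realType) (f df : R -> R) (l : R) :
  (forall x : R, 0 < x -> is_derive x 1 f (df x)) ->
  f @ 0^'+ --> f 0 -> df @ 0^'+ --> l ->
  (fun x => (f x - f 0) / x) @ 0^'+ --> l.
Proof.
move=> fD f0 /cvgrPdist_le dfl; apply/cvgrPdist_le => eps eps0.
have /near_at_right0P[d d0 H] := dfl eps eps0.
apply/near_at_right0P; exists d => // x /andP[x0 xd].
have fc (z : R) : 0 < z -> {for z, continuous f}.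
  by move=> z0; apply/differentiable_continuous/derivable1_diffP/ex_derive/fD.
have [||c] := @MVT R f df 0 x x0.
- by move=> z; rewrite in_itv/= => /andP[z0 _]; exact: fD.
- apply/continuous_within_itvP => //; split=> //.
    by move=> z; rewrite in_itv/= => /andP[z0 _]; exact: fc.
  exact/cvg_at_left_filter/fc.
rewrite in_itv/= => /andP[c0 cx] ->; rewrite subr0 mulfK ?gt_eqF//.
by apply: H; rewrite c0/=; lra.
Qed.

(** * C^2 extension to the closed half line and Taylor expansions *)

Lemma is_derive_continuous (R : realType) (f : R -> R) (x l : R) :
  is_derive x 1 f l -> {for x, continuous f}.
Proof.
by move=> fx; apply/differentiable_continuous/derivable1_diffP/ex_derive.
Qed.

Lemma is_derive_powR_comp (R : realType) (f : R -> R) (x l s : R) :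
  0 < f x -> is_derive x 1 f l ->
  is_derive x 1 (fun y => f y `^ s) (s * f x `^ (s - 1) * l).
Proof.
move=> fx0 fl; have pD := is_derive1_powR s fx0.
exact: (@is_derive1_comp _ (fun y : R => y `^ s) f _ _ _ pD fl).
Qed.

Lemma cvg_powR (R : realType) (T : Type) (F : set_system T) (FF : Filter F)
    (f : T -> R) (c s : R) :
  0 < c -> f @ F --> c -> f x `^ s @[x --> F] --> c `^ s.
Proof.
move=> c0 fc; apply: (cvg_comp f (fun y : R => y `^ s) fc).
exact: is_derive_continuous (is_derive1_powR s c0).
Qed.

Lemma powR_subr (R : realType) (x r s : R) : 0 < x ->
  x `^ (r - s) = x `^ r / x `^ s.
Proof. by move=> x0; rewrite powRB//; apply/implyP => _; rewrite gt_eqF. Qed.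

Lemma powR_addr (R : realType) (x r s : R) : 0 < x ->
  x `^ (r + s) = x `^ r * x `^ s.
Proof. by move=> x0; rewrite powRD//; apply/implyP => _; rewrite gt_eqF. Qed.

(** The function equal to [f] on the open half line and to [l] elsewhere. *)
Definition extend0 (R : realType) (l : R) (f : R -> R) (x : R) : R :=
  if 0 < x then f x else l.

Lemma extend0E (R : realType) (l : R) (f : R -> R) (x : R) :
  0 < x -> extend0 l f x = f x.
Proof. by rewrite /extend0 => ->. Qed.

Lemma extend00 (R : realType) (l : R) (f : R -> R) : extend0 l f 0 = l.
Proof. by rewrite /extend0 ltxx. Qed.

Lemma extend0_cvg (R : realType) (l : R) (f : R -> R) :
  f @ 0^'+ --> l -> extend0 l f @ 0^'+ --> extend0 l f 0.
Proof.
rewrite extend00; apply: cvg_trans; apply: near_eq_cvg.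
by apply/near_at_right0P; exists 1 => // x /andP[x0 _]; rewrite extend0E.
Qed.

Lemma near_extend0 (R : realType) (l : R) (f : R -> R) (x : R) :
  0 < x -> \forall y \near x, f y = extend0 l f y.
Proof.
move=> x0; near=> y; rewrite extend0E//.
by near: y; exact: lt_nbhsr.
Unshelve. all: by end_near. Qed.

Lemma extend0_is_derive (R : realType) (l : R) (f : R -> R) (x df : R) :
  0 < x -> is_derive x 1 f df -> is_derive x 1 (extend0 l f) df.
Proof. by move=> x0; apply: near_eq_is_derive; exact: near_extend0. Qed.

Lemma extend0_derivative_on (R : realType) (l l' : R) (f df : R -> R) :
  (forall x : R, 0 < x -> is_derive x 1 f (df x)) ->
  f @ 0^'+ --> l -> df @ 0^'+ --> l' ->
  derivative_on `[0, +oo[ (extend0 l f) (extend0 l' df).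
Proof.
move=> fD fl dfl x /=; rewrite in_itv/= andbT le_eqVlt => /predU1P[<-|x0].
  have := cvg_derive_endpoint (fun x x0 => extend0_is_derive l x0 (fD x x0))
    (extend0_cvg fl) dfl.
  rewrite [extend0 l' _ _]extend00 => H P /H [d /= d0 Pd].
  exists d => // y /= yd y0; rewrite in_itv/= andbT => y0'.
  rewrite subr0; apply: Pd => //=.
  by rewrite lt_neqAle eq_sym y0 y0'.
have [fdx fx] := extend0_is_derive l x0 (fD x x0).
rewrite [extend0 l' df x]extend0E// -fx.
apply: (@cvg_trans _ ((extend0 l f y - extend0 l f x) / (y - x) @[y --> x^'])).
  by apply: cvg_app; exact: cvg_within.
move: fdx; rewrite /derivable /derive; set F := (X in cvg (X @ _) -> _).
move=> /cvgrPdist_le H; apply/cvgrPdist_le => e e0.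
have [d /= d0 Hd] := H e e0; exists d => // y /= yd yx.
have := Hd (y - x); rewrite /F /ball_/= sub0r normrN distrC subr_eq0.
move=> /(_ yd yx); congr (`|_ - _| <= _).
by rewrite /GRing.scale/= mulr1 subrK mulrC.
Qed.

Lemma extend0_C2_with (R : realType) (l0 l1 l2 : R) (f f1 f2 : R -> R) :
  (forall x : R, 0 < x -> is_derive x 1 f (f1 x)) ->
  (forall x : R, 0 < x -> is_derive x 1 f1 (f2 x)) ->
  (forall x : R, 0 < x -> {for x, continuous f2}) ->
  f @ 0^'+ --> l0 -> f1 @ 0^'+ --> l1 -> f2 @ 0^'+ --> l2 ->
  C2_with `[0, +oo[ (extend0 l0 f) (extend0 l1 f1) (extend0 l2 f2).
Proof.
move=> fD f1D f2c fl f1l f2l; split; [exact: extend0_derivative_on..|].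
apply/continuous_within_itvcyP; split; last exact: extend0_cvg.
move=> x; rewrite in_itv/= andbT => x0.
have := f2c x x0; rewrite /continuous_at extend0E// => H.
by apply: cvg_trans H; apply: near_eq_cvg; exact: near_extend0.
Qed.

(** Peano form of the Taylor expansion at an endpoint, of order one. *)
Lemma taylor1_at_right0 (R : realType) (l0 l1 : R) (f f1 : R -> R) :
  (forall x : R, 0 < x -> is_derive x 1 f (f1 x)) ->
  f @ 0^'+ --> l0 -> f1 @ 0^'+ --> l1 ->
  forall e : R, 0 < e -> \forall x \near 0^'+, `|f x - l0 - l1 * x| <= e * x.
Proof.
move=> fD fl f1l e e0.
have /cvgrPdist_le /(_ e e0) /near_at_right0P [d d0 H] :=
  cvg_derive_endpoint (fun x x0 => extend0_is_derive l0 x0 (fD x x0))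
    (extend0_cvg fl) f1l.
apply/near_at_right0P; exists d => // x /[dup] /andP[x0 _] /H.
rewrite extend0E// extend00 => Hx.
have -> : f x - l0 - l1 * x = - (x * (l1 - (f x - l0) / x)).
  by field; rewrite gt_eqF.
by rewrite normrN normrM [`|x|]gtr0_norm// [leRHS]mulrC ler_pM2l.
Qed.

(** Peano form of the Taylor expansion at an endpoint, of order two. *)
Lemma taylor2_at_right0 (R : realType) (l0 l1 l2 : R) (f f1 f2 : R -> R) :
  (forall x : R, 0 < x -> is_derive x 1 f (f1 x)) ->
  (forall x : R, 0 < x -> is_derive x 1 f1 (f2 x)) ->
  f @ 0^'+ --> l0 -> f1 @ 0^'+ --> l1 -> f2 @ 0^'+ --> l2 ->
  forall e : R, 0 < e ->
    \forall x \near 0^'+, `|f x - l0 - l1 * x - l2 / 2 * x ^+ 2| <= e * x ^+ 2.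
Proof.
move=> fD f1D fl f1l f2l e e0.
have /near_at_right0P [d d0 H] := taylor1_at_right0 f1D f1l f2l e0.
pose g x : R := extend0 l0 f x - l1 * x - l2 / 2 * x ^+ 2.
have gD (x : R) : 0 < x -> is_derive x 1 g (f1 x - l1 - l2 * x).
  move=> x0; have ? := extend0_is_derive l0 x0 (fD x x0).
  by apply: is_derive_eq; rewrite /GRing.scale/=; field.
apply/near_at_right0P; exists d => // x /andP[x0 xd].
have [||c] := @MVT R g (fun x => f1 x - l1 - l2 * x) 0 x x0.
- by move=> z; rewrite in_itv/= => /andP[z0 _]; exact: gD.
- apply/continuous_within_itvP => //; split=> //.
  + move=> z; rewrite in_itv/= => /andP[z0 _].
    exact/is_derive_continuous/gD.
  + have idc : @id R @ 0^'+ --> (0 : R).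
      by apply: cvg_at_right_filter; exact: cvg_id.
    apply: cvgB; [apply: cvgB; [exact: extend0_cvg|]|];
      by [apply: cvgM => //; exact: cvg_cst
         |apply: cvgM; [exact: cvg_cst|rewrite exprS expr1; apply: cvgM]].
  + exact/cvg_at_left_filter/is_derive_continuous/gD.
rewrite in_itv/= => /andP[c0 cx].
have -> : g x - g 0 = f x - l0 - l1 * x - l2 / 2 * x ^+ 2.
  by rewrite /g extend0E// extend00 !mulr0 expr0n/= !mulr0 !subr0; ring.
move=> ->; rewrite subr0 normrM [`|x|]gtr0_norm// expr2 mulrA ler_pM2r//.
apply: le_trans (H c _) _; first by rewrite c0/=; lra.
by rewrite ler_pM2l// ltW.
Qed.

(** * Convergence of the first two derivatives of the rescaled profile *)

(** The radial equation in the variable [x = r^(rho1/beta)], in terms of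
    [h = w^(m-1) w']: it has an irregular singular point at [0]. If [w] has a
    positive limit there, then [w'] and [w''] converge. *)
Lemma profile_ode_cvg (R : realType) (m a1 a2 a3 c : R) (w dw h dh : R -> R) :
  0 < a2 -> 0 < c ->
  (forall x : R, 0 < x -> 0 < w x) ->
  (forall x : R, 0 < x -> is_derive x 1 w (dw x)) ->
  (forall x : R, 0 < x -> dw x = w x `^ (1 - m) * h x) ->
  (forall x : R, 0 < x -> is_derive x 1 h (dh x)) ->
  (forall x : R, 0 < x ->
     x ^+ 2 * dh x =
       - ((a2 * w x `^ (1 - m) + a1 * x) * h x) + a3 * w x `^ m) ->
  w @ 0^'+ --> c ->
  dw @ 0^'+ --> a3 / a2 * c `^ m /\
  exists ddw : R -> R,
    [/\ forall x : R, 0 < x -> is_derive x 1 dw (ddw x),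
        forall x : R, 0 < x -> {for x, continuous ddw} &
        ddw @ 0^'+ --> a3 * (m * a3 - a1) / a2 ^+ 2 * c `^ (2 * m - 1)].
Proof.
move=> a20 c0 w0 wD dwE hD hE wc.
have xc : @id R @ 0^'+ --> (0 : R) by apply: cvg_at_right_filter; exact: cvg_id.
have wsc s : w x `^ s @[x --> 0^'+] --> c `^ s by exact: cvg_powR.
pose P x : R := a2 * w x `^ (1 - m) + a1 * x.
pose q x : R := a3 * w x `^ m.
pose dP x : R := a2 * ((1 - m) * w x `^ (- m) * dw x) + a1.
pose dq x : R := a3 * (m * w x `^ (m - 1) * dw x).
have wpD s (x : R) : 0 < x ->
    is_derive x 1 (fun y => w y `^ s) (s * w x `^ (s - 1) * dw x).
  by move=> x0; apply: is_derive_powR_comp; [exact: w0|exact: wD].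
have PD (x : R) : 0 < x -> is_derive x 1 P (dP x).
  move=> x0; have ? := wpD (1 - m) x x0.
  apply: is_derive_eq; rewrite /GRing.scale/= /dP.
  by rewrite (_ : 1 - m - 1 = - m); ring.
have qD (x : R) : 0 < x -> is_derive x 1 q (dq x).
  by move=> x0; have ? := wpD m x x0; apply: is_derive_eq.
have P_cvg : P @ 0^'+ --> a2 * c `^ (1 - m).
  rewrite -[X in _ --> X]addr0 -[X in _ + X](mulr0 a1).
  by apply: cvgD; apply: cvgM => //; exact: cvg_cst.
have q_cvg : q @ 0^'+ --> a3 * c `^ m by apply: cvgM => //; exact: cvg_cst.
have P0 : 0 < a2 * c `^ (1 - m) by rewrite mulr_gt0// powR_gt0.
have h_small (eps d : R) : 0 < eps -> 0 < d ->
    exists2 x : R, 0 < x < d & `|x * h x| < eps.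
  move=> e0 d0; pose k := c `^ (1 - m) / 2.
  have k0 : 0 < k by rewrite divr_gt0// powR_gt0.
  have kc : k < c `^ (1 - m) by rewrite /k; have := powR_gt0 (1 - m) c0; lra.
  have /near_at_right0P[d1 d10 H] : \forall x \near 0^'+, k <= w x `^ (1 - m).
    exact: (cvgr_ge _ (wsc (1 - m)) k kc).
  have [||x] := cvg_at_right_small_derive wD wc (eps := k * eps)
      (d := Num.min d d1).
  - by rewrite mulr_gt0.
  - by rewrite lt_min d0.
  rewrite lt_min => /and3P[x0 xd xd1]; rewrite dwE// => Hx.
  exists x; first by rewrite x0.
  rewrite -(ltr_pM2l k0); apply: le_lt_trans Hx.
  rewrite [x * (_ * _)]mulrCA [leRHS]normrM (ger0_norm (powR_ge0 _ _)).
  by rewrite ler_wpM2r// H// x0.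
have h_cvg := irregular_ode_cvg P0 hD hE P_cvg q_cvg h_small.
set h0 := (X in _ --> X) in h_cvg.
have dw_cvg : dw @ 0^'+ --> c `^ (1 - m) * h0.
  apply: (@cvg_trans _ (w x `^ (1 - m) * h x @[x --> 0^'+])).
    by apply: near_eq_cvg; apply/near_at_right0P; exists 1 => // x /andP[? _];
       rewrite dwE.
  exact: cvgM.
have dP_cvg : dP @ 0^'+ -->
    a2 * ((1 - m) * c `^ (- m) * (c `^ (1 - m) * h0)) + a1.
  apply: cvgD; last exact: cvg_cst.
  apply: cvgM; first exact: cvg_cst.
  by apply: cvgM => //; apply: cvgM => //; exact: cvg_cst.
have dq_cvg : dq @ 0^'+ --> a3 * (m * c `^ (m - 1) * (c `^ (1 - m) * h0)).
  apply: cvgM; first exact: cvg_cst.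
  by apply: cvgM => //; apply: cvgM => //; exact: cvg_cst.
(* the derivative of the equation is of the same kind, with unknown [h'] *)
pose ddh x : R := (- (dP x * h x + P x * dh x) + dq x - 2 * x * dh x) / x ^+ 2.
have dhD (x : R) : 0 < x -> is_derive x 1 dh (ddh x).
  move=> x0; have ? := PD x x0; have ? := qD x x0; have ? := hD x x0.
  have xV : is_derive x 1 (fun y : R => (y ^+ 2)^-1)
      (- (x ^+ 2) ^- 2 *: (2 * x)).
    apply: is_deriveV; first by rewrite expf_neq0// gt_eqF.
    by apply: is_derive_eq; rewrite /GRing.scale/=; ring.
  apply: (@near_eq_is_derive _ _ _ (fun y => (- (P y * h y) + q y) / y ^+ 2)).
    near=> y; rewrite -hE; first by rewrite mulrC mulKf// expf_neq0// gt_eqF//;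
      near: y; exact: lt_nbhsr.
    by near: y; exact: lt_nbhsr.
  apply: is_derive_eq; rewrite /GRing.scale/= /ddh.
  rewrite -(hE x x0) -/(P x); field; rewrite gt_eqF//.
have ddhE (x : R) : 0 < x ->
    x ^+ 2 * ddh x = - ((P x + 2 * x) * dh x) + (dq x - dP x * h x).
  by move=> x0; rewrite /ddh; field; rewrite gt_eqF.
have dh_cvg : dh @ 0^'+ -->
  (a3 * (m * c `^ (m - 1) * (c `^ (1 - m) * h0)) -
   (a2 * ((1 - m) * c `^ (- m) * (c `^ (1 - m) * h0)) + a1) * h0)
  / (a2 * c `^ (1 - m)).
  apply: (irregular_ode_cvg P0 dhD ddhE).
  - rewrite -[X in _ --> X]addr0 -[X in _ + X](mulr0 2).
    by apply: cvgD => //; apply: cvgM => //; exact: cvg_cst.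
  - by apply: cvgB => //; exact: cvgM.
  - exact: cvg_at_right_small_derive hD h_cvg.
pose ddw x : R := (1 - m) * w x `^ (- m) * dw x * h x + w x `^ (1 - m) * dh x.
have dwD (x : R) : 0 < x -> is_derive x 1 dw (ddw x).
  move=> x0; have ? := wpD (1 - m) x x0; have ? := hD x x0.
  apply: (@near_eq_is_derive _ _ _ (fun y => w y `^ (1 - m) * h y)).
    by near=> y; rewrite dwE//; near: y; exact: lt_nbhsr.
  apply: is_derive_eq; rewrite /GRing.scale/= /ddw.
  by rewrite (_ : 1 - m - 1 = - m); ring.
have cmN0 : c `^ m != 0 by rewrite gt_eqF// powR_gt0.
have cN0 : c != 0 by rewrite gt_eqF.
have a2N0 : a2 != 0 by rewrite gt_eqF.
have c1 : c `^ 1 = c by rewrite powRr1// ltW.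
have E1 : c `^ (1 - m) = c / c `^ m by rewrite powR_subr// c1.
have E2 : c `^ (- m) = (c `^ m)^-1 by rewrite powRN.
have E3 : c `^ (m - 1) = c `^ m / c by rewrite powR_subr// c1.
have E4 : c `^ (2 * m - 1) = c `^ m ^+ 2 / c.
  rewrite powR_subr// c1; congr (_ / _).
  by rewrite -powR_mulrn ?powR_ge0// -powRrM mulrC.
split.
  suff <- : c `^ (1 - m) * h0 = a3 / a2 * c `^ m by [].
  by rewrite /h0 E1; field; rewrite cmN0 cN0 a2N0.
exists ddw; split => //.
  move=> x x0; apply: cvgD; apply: cvgM.
  - apply: cvgM; last exact: is_derive_continuous (dwD x x0).
    apply: cvgM; first exact: cvg_cst.
    exact: is_derive_continuous (wpD (- m) x x0).
  - exact: is_derive_continuous (hD x x0).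
  - exact: is_derive_continuous (wpD (1 - m) x x0).
  - exact: is_derive_continuous (dhD x x0).
set l := (X in _ --> X).
have -> : l = (1 - m) * c `^ (- m) * (c `^ (1 - m) * h0) * h0 +
  c `^ (1 - m) * ((a3 * (m * c `^ (m - 1) * (c `^ (1 - m) * h0)) -
   (a2 * ((1 - m) * c `^ (- m) * (c `^ (1 - m) * h0)) + a1) * h0)
  / (a2 * c `^ (1 - m))).
  by rewrite /l /h0 E1 E2 E3 E4; field; rewrite cmN0 cN0 a2N0.
apply: cvgD; apply: cvgM => //; apply: cvgM => //.
by apply: cvgM => //; exact: cvg_cst.
Unshelve. all: by end_near. Qed.

(** * Radial functions in Euclidean space *)

(** A directional derivative is the derivative at [0] along the line. *)
Lemma is_derive_line (R : numFieldType) (V W : normedModType R) (f : V -> W)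
    (x v : V) (l : W) :
  is_derive x v f l <-> is_derive (0 : R) 1 (fun h : R => f (h *: v + x)) l.
Proof.
have E : 'D_v f x = 'D_1 (fun h : R => f (h *: v + x)) 0.
  rewrite /derive; set g1 := fun h => h^-1 *: _; set g2 := fun h => h^-1 *: _.
  suff -> : g1 = g2 by [].
  apply/funext => h; rewrite /g1 /g2 /=.
  by rewrite addr0 [_%:A]mulr1 scale0r add0r.
split=> -[fx fl]; (apply: DeriveDef; last by rewrite -fl E).
  exact: (derivable1P f x v).1 fx.
exact: (derivable1P f x v).2 fx.
Qed.

Section euclidean_norm.
Context {R : realType} {n : nat}.
Implicit Types x : 'rV[R]_n.

Lemma sqr_enorm x : enorm x ^+ 2 = \sum_(i < n) x 0 i ^+ 2.
Proof. by rewrite sqr_sqrtr// sumr_ge0// => i _; exact: sqr_ge0. Qed.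

Lemma enorm_gt0 x : x != 0 -> 0 < enorm x.
Proof.
move=> /rV0Pn[i xi]; rewrite sqrtr_gt0 (bigD1 i)//=.
rewrite ltr_pwDl//; first by rewrite exprn_even_gt0.
by rewrite sumr_ge0// => j _; exact: sqr_ge0.
Qed.

Lemma sqr_enorm_line x (i : 'I_n) (h : R) :
  enorm (h *: delta_mx 0 i + x) ^+ 2 = enorm x ^+ 2 + 2 * x 0 i * h + h ^+ 2.
Proof.
rewrite !sqr_enorm (bigD1 i)//= [in RHS](bigD1 i)//= !mxE !eqxx.
rewrite (eq_bigr (fun j => x 0 j ^+ 2)); first by rewrite mulr1; ring.
by move=> j ji; rewrite !mxE eqxx/= (negbTE ji) mulr0 add0r.
Qed.

Lemma enorm_scale_delta (i : 'I_n) (r : R) : 0 <= r ->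
  enorm (r *: delta_mx 0 i : 'rV[R]_n) = r.
Proof.
move=> r0; rewrite /enorm (bigD1 i)//= big1 ?addr0.
  by rewrite !mxE !eqxx mulr1 sqrtr_sqr ger0_norm.
by move=> j ji; rewrite !mxE eqxx/= (negbTE ji) mulr0 expr0n.
Qed.

Lemma scale_delta_neq0 (i : 'I_n) (r : R) : 0 < r ->
  r *: delta_mx 0 i != 0 :> 'rV[R]_n.
Proof.
move=> r0; apply/negP => /eqP/rowP/(_ i); rewrite !mxE !eqxx mulr1 => r0'.
by rewrite r0' ltxx in r0.
Qed.

Lemma near_neq0 x : x != 0 -> \forall y \near x, y != 0.
Proof.
by move=> x0; exact: (cvgr_neq0 x (@cvg_id _ (nbhs x)) x0).
Qed.

Lemma is_derive_enorm x (i : 'I_n) : x != 0 ->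
  is_derive x (delta_mx 0 i) (@enorm R n) (x 0 i / enorm x).
Proof.
move=> x0; apply/is_derive_line; have x1 := enorm_gt0 x0.
pose g (h : R) : R := enorm x ^+ 2 + 2 * x 0 i * h + h ^+ 2.
rewrite (_ : (fun h => _) = Num.sqrt \o g); last first.
  apply/funext => h; rewrite /= /g -sqr_enorm_line sqrtr_sqr ger0_norm//.
  exact: sqrtr_ge0.
have g0 : g 0 = enorm x ^+ 2 by rewrite /g mulr0 expr0n/= !addr0.
have gD : is_derive (0 : R) 1 g (2 * x 0 i).
  by apply: is_derive_eq; rewrite /GRing.scale/=; ring.
have gp : 0 < g 0 by rewrite g0 exprn_gt0.
have sD := is_derive1_sqrt gp.
apply: (@is_derive_eq _ _ _ _ _ _ _ _
  (@is_derive1_comp _ Num.sqrt g 0 _ _ sD gD)).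
rewrite g0 sqrtr_sqr ger0_norm ?ltW//.
by field; rewrite gt_eqF.
Qed.

Lemma is_derive_radial (G : R -> R) (dG : R) x (i : 'I_n) : x != 0 ->
  is_derive (enorm x) 1 G dG ->
  is_derive x (delta_mx 0 i) (G \o @enorm R n) (dG * (x 0 i / enorm x)).
Proof.
move=> x0 GD; apply/is_derive_line.
have /is_derive_line ND := is_derive_enorm i x0.
apply: (@is_derive1_comp _ G (fun h => enorm (h *: delta_mx 0 i + x))) => //.
by rewrite scale0r add0r.
Qed.

Lemma is_derive_coord x (i : 'I_n) :
  is_derive x (delta_mx 0 i) (fun y : 'rV[R]_n => y 0 i) 1.
Proof.
apply/is_derive_line.
rewrite (_ : (fun h => _) = fun h => h + x 0 i).
  by apply: is_derive_eq; rewrite addr0.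
by apply/funext => h; rewrite !mxE !eqxx mulr1.
Qed.

Lemma partial_radial (f : 'rV[R]_n -> R) (F F1 : R -> R) x (i : 'I_n) :
  (forall y : 'rV[R]_n, y != 0 -> f y = F (enorm y)) ->
  (forall r : R, 0 < r -> is_derive r 1 F (F1 r)) ->
  x != 0 -> partial i f x = F1 (enorm x) / enorm x * x 0 i.
Proof.
move=> fF FD x0; rewrite /partial.
have D := is_derive_radial i x0 (FD _ (enorm_gt0 x0)).
have nE : \forall y \near x, (F \o @enorm R n) y = f y.
  by near=> y; rewrite /= -fF//; near: y; exact: near_neq0.
have [_ ->] := near_eq_is_derive nE D.
by rewrite mulrA mulrAC.
Unshelve. all: by end_near. Qed.

(** The Laplacian in polar coordinates. *)
Lemma laplacian_radial (f : 'rV[R]_n -> R) (F F1 F2 : R -> R) x :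
  (forall y : 'rV[R]_n, y != 0 -> f y = F (enorm y)) ->
  (forall r : R, 0 < r -> is_derive r 1 F (F1 r)) ->
  (forall r : R, 0 < r -> is_derive r 1 F1 (F2 r)) ->
  x != 0 ->
  laplacian f x = F2 (enorm x) + (n%:R - 1) / enorm x * F1 (enorm x).
Proof.
move=> fF FD F1D x0; have x1 := enorm_gt0 x0; set r := enorm x in x1 *.
pose G s : R := F1 s / s.
pose dG : R := F2 r / r - F1 r / r ^+ 2.
have GD : is_derive r 1 G dG.
  have ? := F1D r x1.
  have ? : is_derive r 1 (fun y : R => y^-1) (- r ^- 2 *: 1).
    by apply: is_deriveV; rewrite gt_eqF.
  by apply: is_derive_eq; rewrite /GRing.scale/= /dG; field; rewrite gt_eqF.
have pE (i : 'I_n) : partial i (partial i f) x = dG / r * x 0 i ^+ 2 + G r.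
  have D1 := is_derive_radial i x0 GD.
  have D2 := is_derive_coord x i.
  have D := is_deriveM D1 D2.
  have nE : \forall y \near x, (G \o @enorm R n) y * y 0 i = partial i f y.
    by near=> y; rewrite (partial_radial _ fF FD)//; near: y; exact: near_neq0.
  rewrite {1}/partial; have [_ ->] := near_eq_is_derive nE D; rewrite /= -/r.
  by rewrite /GRing.scale/=; ring.
rewrite /laplacian (eq_bigr _ (fun i _ => pE i)) big_split/= -mulr_sumr.
rewrite -sqr_enorm -/r sumr_const card_ord -mulr_natr /G /dG.
by field; rewrite gt_eqF.
Unshelve. all: by end_near. Qed.

Lemma x_dot_grad_radial (f : 'rV[R]_n -> R) (F F1 : R -> R) x :
  (forall y : 'rV[R]_n, y != 0 -> f y = F (enorm y)) ->
  (forall r : R, 0 < r -> is_derive r 1 F (F1 r)) ->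
  x != 0 -> x_dot_grad f x = enorm x * F1 (enorm x).
Proof.
move=> fF FD x0; have x1 := enorm_gt0 x0; rewrite /x_dot_grad.
rewrite (eq_bigr (fun i => F1 (enorm x) / enorm x * x 0 i ^+ 2)).
  by rewrite -mulr_sumr -sqr_enorm; field; rewrite gt_eqF.
by move=> i _; rewrite (partial_radial _ fF FD)//; ring.
Qed.

Lemma is_derive_ray (f : 'rV[R]_n -> R) (i : 'I_n) (r : R) :
  derivable f (r *: delta_mx 0 i) (delta_mx 0 i) ->
  is_derive r 1 (fun s : R => f (s *: delta_mx 0 i))
    (partial i f (r *: delta_mx 0 i)).
Proof.
move=> /derivableP/is_derive_line fD; apply/is_derive_line.
rewrite (_ : (fun h => _) =
  fun h : R => f (h *: delta_mx 0 i + r *: delta_mx 0 i))//.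
by apply/funext => h; rewrite [h *: 1]mulr1 scalerDl.
Qed.

Lemma cvg_ray (i : 'I_n) :
  (r *: delta_mx 0 i : 'rV[R]_n) @[r --> 0^'+] --> (0 : 'rV[R]_n)^'.
Proof.
have H : (r *: delta_mx 0 i : 'rV[R]_n) @[r --> 0^'+] --> (0 : 'rV[R]_n).
  rewrite -[X in _ --> X](scale0r (delta_mx 0 i : 'rV[R]_n)).
  apply: cvgZr_tmp.
  by apply: cvg_at_right_filter; exact: cvg_id.
move=> P /H HP.
have {}HP : \forall r \near (0 : R)^'+,
  r *: delta_mx 0 i != 0 :> 'rV[R]_n -> P (r *: delta_mx 0 i) := HP.
suff : \forall r \near (0 : R)^'+, P (r *: delta_mx 0 i) by [].
near=> r; have : r *: delta_mx 0 i != 0 :> 'rV[R]_n by exact: scale_delta_neq0.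
by near: r.
Unshelve. all: by end_near. Qed.

End euclidean_norm.

Lemma is_derive_phi (R : realType) (m u : R) : 0 < u ->
  is_derive u 1 (phi m) (u `^ (m - 1)).
Proof.
move=> u0; rewrite /phi; case: eqVneq => [->|m0].
  by rewrite sub0r powR_inv1 ?ltW//; exact: is_derive1_ln.
have ? := is_derive1_powR m u0.
by apply: is_derive_eq; rewrite /GRing.scale/=; field.
Qed.

(** The radial form of the elliptic equation, in which [vr1] is the derivative
    of [vr], and [f2] that of [vr^(m-1) vr']. *)
Lemma radial_profile_ode (R : realType) (n : nat) (i : 'I_n) (m alpha beta : R)
    (v : 'rV[R]_n -> R) (vr : R -> R) :
  elliptic_solution m alpha beta v -> radial_profile v vr ->
  exists vr1 f2 : R -> R, forall r : R, 0 < r ->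
    [/\ 0 < vr r, is_derive r 1 vr (vr1 r),
        is_derive r 1 (fun s => vr s `^ (m - 1) * vr1 s) (f2 r) &
        f2 r + (n%:R - 1) / r * (vr r `^ (m - 1) * vr1 r) + alpha * vr r +
          beta * (r * vr1 r) = 0].
Proof.
move=> [[C1v C2v] eqv] vvr.
pose e : 'rV[R]_n := delta_mx 0 i.
pose vr1 (s : R) : R := partial i v (s *: e).
pose vr2 (s : R) : R := partial i (partial i v) (s *: e).
have vrE (s : R) : 0 < s -> v (s *: e) = vr s.
  by move=> s0; rewrite vvr ?scale_delta_neq0// enorm_scale_delta// ltW.
have vr0 (r : R) : 0 < r -> 0 < vr r.
  by move=> r0; rewrite -vrE//; have [] := eqv _ (scale_delta_neq0 i r0).
have vrD (r : R) : 0 < r -> is_derive r 1 vr (vr1 r).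
  move=> r0; apply: (@near_eq_is_derive _ _ _ (fun s : R => v (s *: e))).
    by near=> s; rewrite vrE//; near: s; exact: lt_nbhsr.
  apply: is_derive_ray.
  by have [_ /(_ i)[]] := C1v _ (scale_delta_neq0 i r0).
have vr1D (r : R) : 0 < r -> is_derive r 1 vr1 (vr2 r).
  move=> r0; apply: is_derive_ray.
  by have [_ /(_ i)[]] := C2v i _ (scale_delta_neq0 i r0).
pose F1 (r : R) : R := vr r `^ (m - 1) * vr1 r.
pose F2 (r : R) : R := (m - 1) * vr r `^ (m - 1 - 1) * vr1 r * vr1 r +
  vr r `^ (m - 1) * vr2 r.
have FD (r : R) : 0 < r -> is_derive r 1 (phi m \o vr) (F1 r).
  move=> r0; have pD := is_derive_phi m (vr0 r r0).
  exact: (@is_derive1_comp _ (phi m) vr _ _ _ pD (vrD r r0)).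
have F1D (r : R) : 0 < r -> is_derive r 1 F1 (F2 r).
  move=> r0; have ? := vr1D r r0.
  have ? := is_derive_powR_comp (m - 1) (vr0 r r0) (vrD r r0).
  by apply: is_derive_eq; rewrite /GRing.scale/= /F2; ring.
exists vr1, F2 => r r0; split; [exact: vr0|exact: vrD|exact: F1D|].
have re := scale_delta_neq0 i r0.
have [_] := eqv _ re.
have phivE (y : 'rV[R]_n) : y != 0 ->
    (phi m \o v) y = (phi m \o vr) (enorm y) by move=> y0 /=; rewrite vvr.
rewrite (laplacian_radial phivE FD F1D re) (x_dot_grad_radial vvr vrD re).
by rewrite enorm_scale_delta ?ltW// vrE.
Unshelve. all: by end_near. Qed.

(** * Rescaling the radial equation *)

Lemma near_powR_at_right0 (R : realType) (s : R) (P : set R) : 0 < s ->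
  (\forall x \near 0^'+, P x) -> \forall x \near 0^'+, P (x `^ s).
Proof.
move=> s0 /near_at_right0P[d d0 H].
apply/near_at_right0P; exists (d `^ s^-1); first exact: powR_gt0.
move=> x /andP[x0 xd]; apply: H; rewrite powR_gt0//=.
have -> : d = (d `^ s^-1) `^ s.
  by rewrite -powRrM mulVf ?gt_eqF// powRr1// ltW.
by rewrite gt0_ltr_powR// nnegrE ?powR_ge0// ltW.
Qed.

Lemma is_derive_powR_var (R : realType) (x s : R) : 0 < x ->
  is_derive x 1 (fun y : R => y `^ s) (s * x `^ s / x).
Proof.
move=> x0; apply: is_derive_eq (is_derive1_powR s x0) _.
by rewrite powR_subr// powRr1 ?mulrA// ltW.
Qed.

(** The change of variables [x = r^(rho1/beta)], [w(x) = r^(alpha/beta) v(r)],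
    brings the radial equation to the form of [profile_ode_cvg], with
    [h = w^(m-1) w']. *)
Lemma rescaled_profile_ode (R : realType) (n : nat) (m rho1 beta : R)
    (vr vr1 f2 : R -> R) :
  let alpha := alpha_m m rho1 beta in
  let a := alpha / rho1 in let b := beta / rho1 in
  let w (x : R) := x `^ a * vr (x `^ b) in
  let dw (x : R) :=
    x `^ a / x * (a * vr (x `^ b) + b * x `^ b * vr1 (x `^ b)) in
  m < 1 -> 0 < rho1 -> 0 < beta ->
  (forall r : R, 0 < r ->
    [/\ 0 < vr r, is_derive r 1 vr (vr1 r),
        is_derive r 1 (fun s => vr s `^ (m - 1) * vr1 s) (f2 r) &
        f2 r + (n%:R - 1) / r * (vr r `^ (m - 1) * vr1 r) + alpha * vr r +
          beta * (r * vr1 r) = 0]) ->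
  exists h dh : R -> R, forall x : R, 0 < x ->
    [/\ 0 < w x, is_derive x 1 w (dw x), dw x = w x `^ (1 - m) * h x,
        is_derive x 1 h (dh x) &
        x ^+ 2 * dh x =
          - ((coef_a2 rho1 beta * w x `^ (1 - m) +
              coef_a1 n m rho1 beta * x) * h x) +
          coef_a3 n m rho1 beta * w x `^ m].
Proof.
move=> alpha a b w dw m1 rho0 beta0 vrP.
pose f1 (s : R) : R := vr s `^ (m - 1) * vr1 s.
pose h (x : R) : R :=
  x `^ (a * m) / x * (a * vr (x `^ b) `^ m + b * (x `^ b * f1 (x `^ b))).
pose dh (x : R) : R :=
  (a * m - 1) * x `^ (a * m) / x ^+ 2 *
    (a * vr (x `^ b) `^ m + b * (x `^ b * f1 (x `^ b))) +
  x `^ (a * m) / x * (a * (m * f1 (x `^ b) * (b * x `^ b / x)) +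
    b * (b * x `^ b / x * f1 (x `^ b) +
         x `^ b * (f2 (x `^ b) * (b * x `^ b / x)))).
exists h, dh => x x0.
have r0 : 0 < x `^ b by exact: powR_gt0.
have [v0 vD f1D ode] := vrP _ r0.
have rD := is_derive_powR_var b x0.
have xV : is_derive x 1 (fun y : R => y^-1) (- x ^- 2 *: 1).
  by apply: is_deriveV; rewrite gt_eqF.
have VD := @is_derive1_comp _ vr (fun y : R => y `^ b) _ _ _ vD rD.
have FD := @is_derive1_comp _ f1 (fun y : R => y `^ b) _ _ _ f1D rD.
have XD := is_derive_powR_comp m v0 VD.
have aD := is_derive_powR_var a x0.
have ED := is_derive_powR_var (a * m) x0.
have w0 : 0 < w x by rewrite mulr_gt0 ?powR_gt0.
have wD : is_derive x 1 w (dw x).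
  apply: is_derive_eq; rewrite /GRing.scale/= /dw; ring.
have hD : is_derive x 1 h (dh x).
  apply: is_derive_eq; rewrite /GRing.scale/= /dh /f1.
  by field; rewrite gt_eqF.
have xN0 : x != 0 by rewrite gt_eqF.
have m1N0 : 1 - m != 0 by rewrite gt_eqF// subr_gt0.
have rhoN0 : rho1 != 0 by rewrite gt_eqF.
have wm : w x `^ m = x `^ (a * m) * vr (x `^ b) `^ m.
  by rewrite /w powRM ?powR_ge0 ?ltW// -powRrM.
(* [a (1 - m) = 2 b + 1], by the choice of [alpha]: the exponents of [x] in the
   equation match only for this value *)
have xa : x `^ a = x `^ (a * m) * (x * x `^ b ^+ 2).
  have aE : a * m + (1 + b * 2%:R) = a.
    by rewrite /a /b /alpha /alpha_m; field; rewrite rhoN0 m1N0.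
  rewrite -{1}aE powR_addr// powR_addr// powRr1 ?ltW//.
  by rewrite [x `^ (b * _)]powRrM powR_mulrn ?powR_ge0.
have EN0 : x `^ (a * m) != 0 by rewrite gt_eqF ?powR_gt0.
have XN0 : vr (x `^ b) `^ m != 0 by rewrite gt_eqF ?powR_gt0.
have vN0 : vr (x `^ b) != 0 by rewrite gt_eqF.
have rN0 : x `^ b != 0 by rewrite gt_eqF.
have w1m : w x `^ (1 - m) = x * x `^ b ^+ 2 * vr (x `^ b) / vr (x `^ b) `^ m.
  by rewrite powR_subr// powRr1 ?ltW// wm /w xa; field; rewrite EN0 XN0.
have vm1 : vr (x `^ b) `^ (m - 1) = vr (x `^ b) `^ m / vr (x `^ b).
  by rewrite powR_subr// powRr1// ltW.
split => //.
  rewrite w1m /dw /h /f1 vm1 xa.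
  by field; rewrite XN0 vN0 xN0.
rewrite w1m wm /dh /h /f1.
have -> : f2 (x `^ b) = - ((n%:R - 1) / x `^ b *
    (vr (x `^ b) `^ (m - 1) * vr1 (x `^ b)) + alpha * vr (x `^ b) +
    beta * (x `^ b * vr1 (x `^ b))).
  by apply/eqP; rewrite -addr_eq0 -ode; apply/eqP; ring.
rewrite vm1; move: XN0 vN0 rN0.
set r := x `^ b; set E := x `^ (a * m); set X := vr r `^ m; set V := vr r.
set D := vr1 r => XN0 vN0 rN0.
rewrite /a /b /alpha /coef_a1 /coef_a2 /coef_a3 /alpha_m.
by field; rewrite rhoN0 m1N0 vN0 xN0 XN0 rN0.
Qed.

Lemma eqo_at_right0 (R : realType) (f g : R -> R) :
  (forall e : R, 0 < e -> \forall x \near 0^'+, `|f x| <= e * `|g x|) ->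
  f =o_ (0^'+) g.
Proof. by move=> fg; apply/eqoP => e e0; exact: fg. Qed.

(** * Expansion of the singular radial solution at the origin *)

Theorem theorem1p2 (R : realType) (n : nat) (m rho1 lambda beta : R)
    (hn : (3 <= n)%N) (hm0 : 0 <= m) (hm : m < (n%:R - 2) / n%:R)
    (hrho1 : 0 < rho1) (hlambda : 0 < lambda) (hbeta : beta0 n m rho1 < beta)
    (v : 'rV[R]_n -> R) (vr : R -> R) :
  let alpha := alpha_m m rho1 beta in
  let A1 := coef_A1 n m rho1 beta in
  let A2 := coef_A2 n m rho1 beta in
  let c0 := lambda `^ (- (rho1 / ((1 - m) * beta))) in
  let c1 := lambda `^ (- (m * rho1 / ((1 - m) * beta))) in
  let c2 := lambda `^ (- ((2 * m - 1) * rho1 / ((1 - m) * beta))) in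
  elliptic_solution m alpha beta v ->
  radial_profile v vr ->
  enorm x `^ (alpha / beta) * v x @[x --> (0 : 'rV[R]_n)^'] --> c0 ->
  forall wtilde wbar : R -> R,
  (forall r : R, 0 < r -> wtilde r = r `^ (alpha / beta) * vr r) ->
  (forall r : R, 0 < r -> wbar (r `^ (rho1 / beta)) = wtilde r) ->
  [/\ exists w w1 w2 : R -> R,
        [/\ forall rho : R, 0 < rho -> w rho = wbar rho,
            C2_with `[0, +oo[ w w1 w2,
            w 0 = c0,
            w1 0 = A1 * c1 &
            w2 0 = A2 * c2],
      exists2 e : R -> R, e =o_ (0^'+) (fun rho : R => rho ^+ 2) &
        forall rho : R, 0 < rho ->
          wbar rho = c0 + A1 * c1 * rho + A2 / 2 * c2 * rho ^+ 2 + e rho,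
      exists2 e : R -> R, e =o_ (0^'+) (fun rho : R => rho) &
        forall rho : R, 0 < rho ->
          (wbar^`())%classic rho = A1 * c1 + A2 * c2 * rho + e rho,
      exists2 e : R -> R, e =o_ (0^'+) (fun r : R => r `^ (2 * rho1 / beta)) &
        forall r : R, 0 < r ->
          vr r = r `^ (- (alpha / beta)) *
            (c0 + A1 * c1 * r `^ (rho1 / beta)
             + A2 / 2 * c2 * r `^ (2 * rho1 / beta) + e r) &
      exists2 e : R -> R, e =o_ (0^'+) (fun r : R => r `^ (rho1 / beta)) &
        forall r : R, 0 < r ->
          (vr^`())%classic r = r `^ (- (alpha / beta) - 1) *
            (- (alpha / beta) * c0
             - (2 * beta + m * rho1) / ((1 - m) * beta) * A1 * c1
               * r `^ (rho1 / beta) + e r)].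
Proof.
move=> alpha A1 A2 c0 c1 c2 solv radv v_cvg wtilde wbar wtildeE wbarE.
have nn0 : 0 < n%:R :> R by rewrite ltr0n; exact: leq_trans hn.
have nm2 : 0 < n%:R - 2 - n%:R * m.
  by move: hm; rewrite ltr_pdivlMr//; lra.
have beta_gt0 : 0 < beta.
  by apply: le_lt_trans hbeta; rewrite /beta0 divr_ge0 ?mulr_ge0// ltW.
have m1 : m < 1 by apply: lt_trans hm _; rewrite ltr_pdivrMr//; lra.
have m1N0 : 1 - m != 0 by rewrite gt_eqF// subr_gt0.
have betaN0 : beta != 0 by rewrite gt_eqF.
have rhoN0 : rho1 != 0 by rewrite gt_eqF.
have lc0 : 0 < c0 by exact: powR_gt0.
(* [c1] and [c2] are the powers of [c0] produced by [profile_ode_cvg] *)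
have c1E : c1 = c0 `^ m.
  by rewrite /c1 /c0 -powRrM; congr (_ `^ _); field; rewrite m1N0 betaN0.
have c2E : c2 = c0 `^ (2 * m - 1).
  by rewrite /c2 /c0 -powRrM; congr (_ `^ _); field; rewrite m1N0 betaN0.
pose i : 'I_n := Ordinal (leq_trans (isT : (0 < 3)%N) hn).
have [vr1 [f2 vrP]] := radial_profile_ode i solv radv.
pose a := alpha / rho1; pose b := beta / rho1; pose k := rho1 / beta.
have b0 : 0 < b by rewrite divr_gt0.
have k0 : 0 < k by rewrite divr_gt0.
pose w (x : R) : R := x `^ a * vr (x `^ b).
pose dw (x : R) : R :=
  x `^ a / x * (a * vr (x `^ b) + b * x `^ b * vr1 (x `^ b)).
have powbk (x : R) : 0 < x -> (x `^ b) `^ k = x.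
  move=> x0; rewrite -powRrM (_ : b * k = 1) ?powRr1 ?ltW//.
  by rewrite /b /k; field; rewrite rhoN0 betaN0.
have powkb (x : R) : 0 < x -> (x `^ k) `^ b = x.
  by move=> x0; rewrite powRAC powbk.
have powka (x : R) : (x `^ k) `^ a = x `^ (alpha / beta).
  rewrite -powRrM; congr (_ `^ _).
  by rewrite /k /a; field; rewrite rhoN0 betaN0.
have wbarw (x : R) : 0 < x -> w x = wbar x.
  move=> x0; rewrite -{2}(powbk _ x0) wbarE ?powR_gt0// wtildeE ?powR_gt0//.
  by rewrite -powka powbk.
have [h [dh hP]] := rescaled_profile_ode m1 hrho1 beta_gt0 vrP.
have vr_cvg : r `^ (alpha / beta) * vr r @[r --> 0^'+] --> c0.
  apply: cvg_trans (cvg_comp _ _ (cvg_ray (R := R) i) v_cvg).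
  apply: near_eq_cvg; apply/near_at_right0P; exists 1 => // r /andP[r0 _] /=.
  by rewrite radv ?scale_delta_neq0// enorm_scale_delta// ltW.
have w_cvg : w @ 0^'+ --> c0.
  apply/cvgrPdist_le => e e0; move/cvgrPdist_le : vr_cvg => /(_ e e0).
  move=> /(near_powR_at_right0 b0) /near_at_right0P[d d0 H].
  apply/near_at_right0P; exists d => // x /[dup] /H /[swap] /andP[x0 _].
  by rewrite -powka powbk.
have a20 : 0 < coef_a2 rho1 beta by rewrite divr_gt0// exprn_gt0.
have [] := profile_ode_cvg a20 lc0 _ _ _ _ _ w_cvg (dw := dw) (h := h)
  (dh := dh) (a1 := coef_a1 n m rho1 beta) (a3 := coef_a3 n m rho1 beta)
  (m := m); try by move=> x /hP[].
rewrite -/(coef_A1 n m rho1 beta) -/A1 -c1E => dw_cvg [ddw [dwD ddw_cont]].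
rewrite -c2E -/(coef_A2 n m rho1 beta) -/A2 => ddw_cvg.
have wD (x : R) : 0 < x -> is_derive x 1 w (dw x) by move=> /hP[].
have wbarD (x : R) : 0 < x -> is_derive x 1 wbar (dw x).
  move=> x0; apply: near_eq_is_derive (wD x x0).
  by near=> y; rewrite wbarw//; near: y; exact: lt_nbhsr.
have wbar_cvg : wbar @ 0^'+ --> c0.
  apply: cvg_trans w_cvg; apply: near_eq_cvg.
  by apply/near_at_right0P; exists 1 => // x /andP[x0 _]; rewrite wbarw.
have vrw (r : R) : 0 < r -> vr r = r `^ (- (alpha / beta)) * wbar (r `^ k).
  move=> r0; rewrite wbarE// wtildeE// powRN mulKf// gt_eqF// powR_gt0//.
have sqrk (r : R) : (r `^ k) ^+ 2 = r `^ (2 * rho1 / beta).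
  rewrite -powR_mulrn; last exact: powR_ge0.
  by rewrite -powRrM; congr (_ `^ _); rewrite /k; field.
have taylor2 := taylor2_at_right0 wbarD dwD wbar_cvg dw_cvg ddw_cvg.
split.
- exists (extend0 c0 wbar), (extend0 (A1 * c1) dw), (extend0 (A2 * c2) ddw).
  split; rewrite ?extend00//; first by move=> x x0; rewrite extend0E.
  exact: extend0_C2_with.
- exists (fun x => wbar x - c0 - A1 * c1 * x - A2 * c2 / 2 * x ^+ 2).
    apply: eqo_at_right0 => e e0; apply: near_at_right0S (taylor2 e e0) => x _.
    by rewrite [`|x ^+ 2|]ger0_norm// sqr_ge0.
  by move=> x x0; field.
- exists (fun x => dw x - A1 * c1 - A2 * c2 * x).
    apply: eqo_at_right0 => e e0.
    have T := taylor1_at_right0 dwD dw_cvg ddw_cvg e0.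
    by apply: near_at_right0S T => x x0; rewrite [`|x|]gtr0_norm.
  by move=> x x0; rewrite derive1E; have [_ ->] := wbarD x x0; ring.
- exists (fun r => wbar (r `^ k) - c0 - A1 * c1 * r `^ k -
    A2 * c2 / 2 * r `^ k ^+ 2).
    apply: eqo_at_right0 => e e0.
    apply: near_at_right0S (near_powR_at_right0 k0 (taylor2 e e0)) => r _.
    by rewrite -sqrk [`|(r `^ k) ^+ 2|]ger0_norm// sqr_ge0.
  by move=> r r0; rewrite vrw// -sqrk -/k; congr (_ * _); field.
- exists (fun r => k * r `^ k * (dw (r `^ k) - A1 * c1) -
    alpha / beta * (wbar (r `^ k) - c0 - A1 * c1 * r `^ k)).
    (* the remainder is [k x (w' - A1 c1) - (alpha/beta) (w - c0 - A1 c1 x)],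
       with [x = r^k]; both brackets are controlled by the expansion of [w] *)
    pose K := k + `|alpha / beta|.
    have K0 : 0 < K by rewrite ltr_wpDr.
    apply: eqo_at_right0 => e e0; have eK : 0 < e / K by rewrite divr_gt0.
    move/cvgrPdist_le : (dw_cvg) => /(_ _ eK) dwN.
    have wN := taylor1_at_right0 wbarD wbar_cvg dw_cvg eK.
    have N1 := near_powR_at_right0 k0 dwN.
    have N2 := near_powR_at_right0 k0 wN.
    have N : \forall r \near 0^'+, `|A1 * c1 - dw (r `^ k)| <= e / K /\
        `|wbar (r `^ k) - c0 - A1 * c1 * r `^ k| <= e / K * r `^ k.
      by near=> r; split; near: r; [exact: N1|exact: N2].
    apply: near_at_right0S N => r _ [] /=; rewrite distrC -/k.
    set x := r `^ k; have x0 : 0 <= x by exact: powR_ge0.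
    move=> H1 H2; rewrite [`|x|]ger0_norm//.
    apply: le_trans (ler_normB _ _) _.
    have -> : e * x = k * x * (e / K) + `|alpha / beta| * (e / K * x).
      by rewrite /K; field; rewrite gt_eqF.
    have kx : 0 <= k * x by rewrite (mulr_ge0 (ltW k0)).
    rewrite normrM (ger0_norm kx) [`|alpha / beta * _|]normrM.
    by apply: lerD; apply: ler_wpM2l.
  move=> r r0; have [_ vrD _ _] := vrP r r0.
  rewrite derive1E; have [_ ->] := vrD.
  have wE := wbarw _ (powR_gt0 k r0).
  rewrite -wE /w /dw -/k powkb// powka powR_subr// powRN powRr1 ?ltW//.
  have EN0 : r `^ (alpha / beta) != 0 by rewrite gt_eqF// powR_gt0.
  have xN0 : r `^ k != 0 by rewrite gt_eqF// powR_gt0.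
  have rN0 : r != 0 by rewrite gt_eqF.
  set E := r `^ (alpha / beta) in EN0 *; set x := r `^ k in xN0 *.
  rewrite /k /a /b /alpha /alpha_m.
  by field; rewrite ?rhoN0 ?betaN0 ?m1N0 ?EN0 ?xN0 ?rN0.
Unshelve. all: by end_near. Qed.
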